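(* Let $G=(V,E)$ be a finite graph. The following statements are equivalent: (1) Every assignment $w:V\to\mathbb{N}_0$ is equatable in $G$. (2) $G$ is connected, $|V|$ is odd, and for every nonempty $U\subseteq V$ the graph $G-U$ has fewer than $|U|$ isolated vertices, where $G-U$ denotes the subgraph of $G$ induced by $V\setminus U$.
   Context: For a weight function $w:V\to\mathbb{N}_0$ on the vertices of $G$ and an edge $e=\{u,v\}\in E$, a positive step on $e$ modifies $w$ by increasing each of $w(u)$ and $w(v)$ by $1$. The assignment $w$ is called equatable in $G$ if there is a finite sequence of positive steps (on edges of $G$, repetitions allowed) after which all vertices have the same weight. *)

(* Defs.v *)
From mathcomp Require Import all_boot.
Set Implicit Arguments. Unset Strict Implicit. Unset Printing Implicit Defensive.

(* Finite simple graphs; the empty graph is allowed, since G - U may be empty. *)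
Record sgraph := SGraph {
  vertex :> finType;
  adj : rel vertex;
  adj_sym : symmetric adj;
  adj_irr : irreflexive adj }.
Arguments adj {s} _ _ : rename.

Section Induced.
Variables (G : sgraph) (A : {set G}).

Definition induced_adj : rel {x : G | x \in A} := fun x y => adj (val x) (val y).

Lemma induced_adj_sym : symmetric induced_adj.
Proof. by move=> x y; apply: adj_sym. Qed.

Lemma induced_adj_irr : irreflexive induced_adj.
Proof. by move=> x; apply: adj_irr. Qed.

Definition induced : sgraph := SGraph induced_adj_sym induced_adj_irr.
End Induced.

Definition remove_vertices (G : sgraph) (U : {set G}) : sgraph := induced (~: U).

Definition isolated (G : sgraph) : {set G} := [set x | [forall y, ~~ adj x y]].

Definition connected (G : sgraph) : Prop := forall x y : G, connect adj x y.

(* An edge {u, v} is encoded by either of the ordered pairs (u, v), (v, u). *)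
Definition positive_step (G : sgraph) (w : {ffun G -> nat}) (e : G * G) :
    {ffun G -> nat} :=
  [ffun x => if (x == e.1) || (x == e.2) then (w x).+1 else w x].

Definition equatable (G : sgraph) (w : {ffun G -> nat}) : Prop :=
  exists s : seq (G * G),
    all (fun e => adj e.1 e.2) s /\
    forall x y : G, foldl (@positive_step G) w s x = foldl (@positive_step G) w s y.

(* Main.v *)
Require Import Defs.
From mathcomp Require Import all_boot.
Set Implicit Arguments.
Unset Strict Implicit.
Unset Printing Implicit Defensive.

(**
  Necessity is counting.  A step changes the total weight of a set D closed
  under adjacency by an even amount, so equating the indicator of a vertex of D
  forces #|D| to be odd; applied to V, to a component and to its complement
  this gives oddness and connectedness.  If I is the set of isolated vertices
  of G - U, a step raises the weight of U at least as much as that of I, so the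
  indicator of U can only be equated when #|I| < #|U|.

  Sufficiency: the isolation condition gives #|N(S)| > #|S| for every nonempty
  proper S, so by Hall's theorem there is, for all vertices v and u, a bijection
  f : V \ v -> V \ u along edges.  A step on each edge {x, f x} adds 2
  everywhere, except for a defect of 1 at v and 1 at u (2 if u = v), hence
  equates the weight that is 1 at v and 1 at u.  Adding up such pairs equates
  every weight of even sum, and since #|V| is odd, w or w + 1 has an even sum.
*)

Section HallMarriage.
Variables T T' : finType.
Implicit Types (A B S : {set T}) (C : {set T'}) (N : T -> {set T'}).
Implicit Types (f g : T -> T').

Definition hall_condition N A :=
  forall S, S \subset A -> #|S| <= #|\bigcup_(x in S) N x|.

Definition matching N A f :=
  {in A, forall x, f x \in N x} /\ {in A &, injective f}.

Lemma bigcup_setDl S N C :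
  \bigcup_(x in S) (N x :\: C) = (\bigcup_(x in S) N x) :\: C.
Proof.
by rewrite setDE big_distrl /=; apply: eq_bigr => x _; rewrite setDE.
Qed.

Lemma matching_glue N A B C f g :
    {in B, forall x, f x \in C} -> matching N B f ->
    matching (fun x => N x :\: C) (A :\: B) g ->
  matching N A (fun x => if x \in B then f x else g x).
Proof.
move=> f_C [f_N f_inj] [g_NC g_inj].
have g_outside x : x \in A -> x \notin B -> g x \notin C /\ g x \in N x.
  by move=> xA xB; move: (g_NC x); rewrite !inE xA xB => /(_ isT) /andP[].
split=> [x xA|x y xA yA].
  by case: ifPn => [/f_N //|xB]; case: (g_outside x xA xB).
case: ifPn => xB; case: ifPn => yB.
- exact: f_inj.
- by move=> fx_gy; case: (g_outside y yA yB); rewrite -fx_gy f_C.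
- by move=> gx_fy; case: (g_outside x xA xB); rewrite gx_fy f_C.
- by apply: g_inj; rewrite inE ?xA ?yA ?xB ?yB.
Qed.

Lemma hall_condition_tight N A B :
    B \subset A -> #|\bigcup_(x in B) N x| <= #|B| -> hall_condition N A ->
  hall_condition (fun x => N x :\: \bigcup_(y in B) N y) (A :\: B).
Proof.
move=> sBA tight hallA S; rewrite subsetD disjoint_sym => /andP[sSA dBS].
rewrite bigcup_setDl; set NB := \bigcup_(x in B) N x in tight *.
have := hallA (B :|: S); rewrite subUset sBA sSA => /(_ isT).
rewrite bigcup_setU -/NB cardsU disjoint_setI0 // cards0 subn0 => le_BS.
rewrite -(leq_add2l #|B|) (leq_trans le_BS) //.
rewrite -(cardsID NB) setUK setDUl setDv set0U.
by rewrite leq_add2r.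
Qed.

Lemma hall_condition_setD1 N A b :
    (forall S, S \subset A -> S != set0 -> #|S| < #|\bigcup_(x in S) N x|) ->
  hall_condition (fun x => N x :\ b) A.
Proof.
move=> surplus S sSA; rewrite bigcup_setDl.
have [->|S0] := eqVneq S set0; first by rewrite cards0.
rewrite -ltnS (leq_trans (surplus S sSA S0)) // [leqLHS](cardsD1 b).
by case: (b \in _).
Qed.

(* Either some nonempty proper subset S of A is tight, and S and A :\: S can be
   matched separately, or a can be matched to any b in N a. *)
Theorem hall_marriage (y0 : T') N A :
  hall_condition N A -> exists f, matching N A f.
Proof.
have [n] := ubnP #|A|; elim: n => // n IHn in N A *; rewrite ltnS => leAn hallA.
have [->|[a aA]] := set_0Vmem A.
  by exists (fun=> y0); split=> [x|x y]; rewrite inE.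
have [/existsP[S /and3P[S0 SA tight]]|/existsPn no_tight] :=
  boolP [exists S : {set T},
    [&& S != set0, S \proper A & #|\bigcup_(x in S) N x| <= #|S|]].
- have sSA := proper_sub SA.
  have [||f f_match] := IHn N S.
  + exact: leq_trans (proper_card SA) leAn.
  + by move=> S' sS'S; apply: hallA (subset_trans sS'S sSA).
  have [|g g_match] := IHn _ _ _ (hall_condition_tight sSA tight hallA).
    rewrite cardsDS //; apply: leq_trans leAn.
    by rewrite ltn_subrL !card_gt0 S0; apply/set0Pn; exists a.
  exists (fun x => if x \in S then f x else g x).
  apply: matching_glue g_match => //.
  by move=> x xS; apply/bigcupP; exists x => //; apply: f_match.1.
have [b bNa] : exists b, b \in N a.
  apply/set0Pn; rewrite -card_gt0.
  by have := hallA [set a]; rewrite sub1set aA cards1 big_set1 => ->.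
have [||g g_match] := IHn (fun x => N x :\ b) (A :\ a).
- by move: leAn; rewrite (cardsD1 a) aA.
- apply: hall_condition_setD1 => S sSAa S0.
  have := no_tight S; rewrite S0 (sub_proper_trans sSAa (properD1 aA)) /=.
  by rewrite -ltnNge.
exists (fun x => if x \in [set a] then b else g x).
apply: matching_glue g_match; first by move=> x _; rewrite inE.
by split=> [x /set1P-> //|x y /set1P-> /set1P->].
Qed.

End HallMarriage.

Lemma near_perfect_matching (T : finType) (N : T -> {set T}) v u :
    (forall S : {set T},
      S != set0 -> S != setT -> #|S| < #|\bigcup_(x in S) N x|) ->
  exists2 f, matching N [set~ v] f & f @: [set~ v] = [set~ u].
Proof.
move=> expand.
have [|f [f_N f_inj]] := @hall_marriage _ _ u (fun x => N x :\ u) [set~ v].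
  apply: hall_condition_setD1 => S sSv S0; apply: expand => //.
  by apply: contraTneq sSv => ->; apply/subsetPn; exists v; rewrite !inE ?eqxx.
exists f; first by split=> // x /f_N /setD1P[].
apply/eqP; rewrite eqEcard card_in_imset // !cardsC1 leqnn andbT.
by apply/subsetP => _ /imsetP[x /f_N /setD1P[fx_u _] ->]; rewrite !inE.
Qed.

Section Counting.
Variable T : finType.
Implicit Types (s : seq (T * T)) (w : {ffun T -> nat}) (A B : {set T}).
Implicit Types (f : T -> T).

Lemma sum_nat_mem A B : \sum_(x in A) (x \in B) = #|A :&: B|.
Proof.
by rewrite -sum1_card -big_mkcondr; apply: eq_bigl => x; rewrite inE.
Qed.

Lemma sum_nat_eq_mem A z : \sum_(x in A) (x == z) = (z \in A).
Proof.
under eq_bigr do rewrite -in_set1.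
rewrite sum_nat_mem; have [zA|zA] := boolP (z \in A).
  by rewrite (setIidPr _) ?sub1set ?cards1.
by apply/eqP; rewrite cards_eq0 setI_eq0 disjoint_sym disjoints1.
Qed.

Lemma sum_natS_split w n :
    \sum_x w x = n.+1 ->
  exists v (w' : {ffun T -> nat}),
    w = [ffun x => (x == v) + w' x] /\ \sum_x w' x = n.
Proof.
move=> sumw.
have /existsP[v wv] : [exists v, w v != 0].
  apply: contra_eqT sumw => /existsPn w0.
  by rewrite big1 // => x _; apply/eqP; rewrite -[_ == _]negbK w0.
pose w' := [ffun x => w x - (x == v)].
have w_split : w = [ffun x => (x == v) + w' x].
  apply/ffunP => x; rewrite !ffunE subnKC //.
  by case: eqP => // ->; rewrite lt0n.
exists v, w'; split=> //; apply/eqP; rewrite -eqSS -sumw w_split.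
under [X in _ == X]eq_bigr do rewrite ffunE.
by rewrite big_split -big_mkcond /= big_pred1_eq.
Qed.

Definition indicator A : {ffun T -> nat} := [ffun x => x \in A : nat].

Lemma sum_indicator A B : \sum_(x in A) indicator B x = #|A :&: B|.
Proof.
by rewrite -sum_nat_mem; apply: eq_bigr => x _; rewrite ffunE.
Qed.

(* A sequence of pairs is read as the edge list of a multigraph. *)
Definition degree s x := \sum_(e <- s) ((x == e.1) + (x == e.2)).

Lemma degree_cat s1 s2 x : degree (s1 ++ s2) x = degree s1 x + degree s2 x.
Proof. exact: big_cat. Qed.

Lemma sum_degree s A :
  \sum_(x in A) degree s x = \sum_(e <- s) ((e.1 \in A) + (e.2 \in A)).
Proof.
rewrite exchange_big; apply: eq_bigr => e _.
by rewrite big_split /= !sum_nat_eq_mem.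
Qed.

Lemma degree_graph A f x : {in A &, injective f} ->
  degree [seq (y, f y) | y in A] x = (x \in A) + (x \in f @: A).
Proof.
move=> f_inj; rewrite /degree big_image /= big_split /=.
under eq_bigr do rewrite eq_sym; under [X in _ + X]eq_bigr do rewrite eq_sym.
rewrite sum_nat_eq_mem -(big_imset (fun y => nat_of_bool (y == x)) f_inj).
by rewrite sum_nat_eq_mem.
Qed.

End Counting.

Section Neighborhoods.
Variable G : sgraph.
Implicit Types (A D I U : {set G}).

Definition neighbors (x : G) : {set G} := [set y | adj x y].
Definition neighborhood A : {set G} := \bigcup_(x in A) neighbors x.

Lemma neighborhoodP A y :
  reflect (exists2 x, x \in A & adj x y) (y \in neighborhood A).
Proof.
by apply: (iffP bigcupP) => -[x xA xy]; exists x => //; move: xy; rewrite inE.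
Qed.

Lemma disjoint_neighborhood A D :
  [disjoint neighborhood A & D] = [disjoint A & neighborhood D].
Proof.
have adj_disjoint (B C : {set G}) :
    [disjoint B & neighborhood C] -> [disjoint neighborhood B & C].
  rewrite -!setI_eq0.
  apply: contraLR => /set0Pn[y /setIP[/neighborhoodP[x xB xy] yC]].
  apply/set0Pn; exists x; rewrite inE xB; apply/neighborhoodP.
  by exists y; rewrite // adj_sym.
apply/idP/idP; last exact: adj_disjoint.
by rewrite disjoint_sym => /adj_disjoint; rewrite disjoint_sym.
Qed.

Lemma adj_connect_sym : connect_sym (@adj G).
Proof. exact/sym_connect_sym/adj_sym. Qed.

Lemma closed_neighborhood D :
  neighborhood D \subset D -> closed (@adj G) D.
Proof.
move=> /subsetP sND; apply: (intro_closed adj_connect_sym) => x y xy xD.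
by apply: sND; apply/neighborhoodP; exists x.
Qed.

Lemma connected_closed D :
  connected G -> closed (@adj G) D -> D != set0 -> D = setT.
Proof.
move=> connG closD /set0Pn[x xD]; apply/setP => y.
by rewrite inE -(closed_connect closD (connG x y)).
Qed.

Lemma odd_closed_connected : odd #|G| ->
    (forall D, closed (@adj G) D -> D != set0 -> odd #|D|) ->
  connected G.
Proof.
move=> oddG odd_closed x y; pose D := [set z | connect adj x z].
have closD : closed (@adj G) D.
  by move=> a b ab; rewrite !inE; apply: (connect_closed adj_connect_sym).
have odd_cardD : odd #|D|.
  by apply: odd_closed => //; apply/set0Pn; exists x; rewrite inE.
apply: contraLR oddG => xNy; rewrite -(cardsC D) oddD odd_cardD.
rewrite odd_closed //.
  by move=> a b ab; rewrite !in_setC (closD a b ab).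
by apply/set0Pn; exists y; rewrite !inE.
Qed.

Definition isolated_by U : {set G} := [set x in ~: U | neighbors x \subset U].

Lemma card_isolated_by U : #|isolated (remove_vertices U)| = #|isolated_by U|.
Proof.
rewrite -(card_imset _ val_inj); apply: eq_card => x.
apply/imsetP/setIdP => [[z z_iso ->]|[xU /subsetP sNxU]].
  split; first exact: valP z.
  apply/subsetP => y; rewrite inE.
  apply: contraLR => yNU; have yU : y \in ~: U by rewrite inE.
  by move: z_iso; rewrite inE => /forallP/(_ (Sub y yU)).
exists (Sub x xU : remove_vertices U) => //; rewrite inE; apply/forallP => y.
by apply/negP => xy; have := valP y; rewrite inE sNxU ?inE.
Qed.

Lemma neighborhood_isolated_by U : neighborhood (isolated_by U) \subset U.
Proof. by apply/bigcupsP => x /setIdP[]. Qed.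

Lemma disjoint_isolated_by U : [disjoint isolated_by U & U].
Proof. by rewrite disjoints_subset; apply/subsetP => x /setIdP[]. Qed.

Lemma sub_isolated_by I U :
  [disjoint I & U] -> neighborhood I \subset U -> I \subset isolated_by U.
Proof.
rewrite disjoints_subset => /subsetP sICU /bigcupsP sNIU.
by apply/subsetP => x xI; rewrite inE sICU ?sNIU.
Qed.

End Neighborhoods.

Section Expansion.
Variable G : sgraph.
Implicit Types (I S U : {set G}).
Hypothesis connG : connected G.
Hypothesis isolation : forall U, U != set0 -> #|isolated_by U| < #|U|.

Lemma independent_card_lt_neighborhood I :
    [disjoint I & neighborhood I] -> I != set0 -> I != setT ->
  #|I| < #|neighborhood I|.
Proof.
move=> indepI I0 IT; apply: leq_ltn_trans (isolation _).
  exact/subset_leq_card/sub_isolated_by.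
apply: contraNneq IT => NI0; apply/eqP/connected_closed => //.
by apply: closed_neighborhood; rewrite NI0 sub0set.
Qed.

(* The part I of S outside N(S) is independent, and N(I) avoids S. *)
Lemma card_lt_neighborhood S :
  S != set0 -> S != setT -> #|S| < #|neighborhood S|.
Proof.
move=> S0 ST; set NS := neighborhood S; pose I := S :\: NS.
have [sSN|] := boolP (S \subset NS).
  apply: proper_card; rewrite properE sSN; apply: contra ST => sNS.
  exact/eqP/connected_closed/S0/closed_neighborhood.
rewrite -setD_eq0 -/I => I0.
have sIS : I \subset S by apply: subsetDl.
have sNI : neighborhood I \subset NS.
  by apply/bigcupsP => x /(subsetP sIS) xS; apply: bigcup_sup xS.
have dNIS : [disjoint neighborhood I & S].
  by rewrite disjoint_neighborhood disjoints_subset subsetDr.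
have ltI : #|I| < #|neighborhood I|.
  apply: independent_card_lt_neighborhood => //.
    by rewrite disjoint_sym (disjointWr sIS).
  by apply: contraNneq ST => IT; rewrite -subTset -IT.
rewrite -(cardsID NS S) -(cardsID S NS) setIC ltn_add2l (leq_trans ltI) //.
by rewrite subset_leq_card // subsetD sNI.
Qed.

End Expansion.

Section Equatable.
Variable G : sgraph.
Implicit Types (s : seq (G * G)) (w : {ffun G -> nat}) (A D I U : {set G}).

Definition edge_seq s := all (fun e => adj e.1 e.2) s.

Lemma foldl_positive_step w s x :
  edge_seq s -> foldl (@positive_step G) w s x = w x + degree s x.
Proof.
elim: s w => [|e s IHs] w /=; first by rewrite /degree big_nil addn0.
case/andP=> ade ads; rewrite IHs // /degree big_cons ffunE addnA; congr (_ + _).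
have [->|_] := eqVneq x e.1; last by case: eqP; rewrite ?addn0 ?addn1.
have /negPf-> : e.1 != e.2 by apply: contraTneq ade => ->; rewrite adj_irr.
by rewrite addn1.
Qed.

Lemma equatableP w : equatable w <->
  exists s c, edge_seq s /\ forall x, w x + degree s x = c.
Proof.
split=> [[s [ads eqs]]|[s [c [ads eqs]]]]; last first.
  by exists s; split=> // x y; rewrite !foldl_positive_step // !eqs.
have [x0|G0] := pickP (@predT G); last first.
  by exists s, 0; split=> // x; have := G0 x.
exists s, (w x0 + degree s x0); split=> // x.
by rewrite -!foldl_positive_step.
Qed.

Lemma equatable_const c : equatable [ffun _ : G => c].
Proof. by exists [::]; split=> // x y; rewrite !ffunE. Qed.

Lemma equatable_add w1 w2 :
  equatable w1 -> equatable w2 -> equatable [ffun x => w1 x + w2 x].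
Proof.
move=> /equatableP[s1 [c1 [ads1 eqs1]]] /equatableP[s2 [c2 [ads2 eqs2]]].
apply/equatableP; exists (s1 ++ s2), (c1 + c2); split.
  by rewrite /edge_seq all_cat; apply/andP.
by move=> x; rewrite ffunE degree_cat addnACA eqs1 eqs2.
Qed.

Lemma equatable_addn_cancel w c : equatable [ffun x => w x + c] -> equatable w.
Proof.
move=> /equatableP[s [d [ads eqs]]].
apply/equatableP; exists s, (d - c); split=> // x.
by rewrite -(eqs x) ffunE addnAC addnK.
Qed.

Lemma sum_equated w s c A : (forall x, w x + degree s x = c) ->
  \sum_(x in A) w x + \sum_(x in A) degree s x = #|A| * c.
Proof.
by move=> eqs; rewrite -big_split -sum_nat_const; apply: eq_bigr => x _.
Qed.

Lemma equatable_odd_closed D w : closed (@adj G) D ->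
  equatable w -> odd (\sum_(x in D) w x) -> odd #|D|.
Proof.
move=> closD /equatableP[s [c [/allP ads eqs]]] oddw.
have even_degree : ~~ odd (\sum_(x in D) degree s x).
  rewrite sum_degree big_seq; elim/big_ind: _ => // [m n|e /ads /closD ->].
    by rewrite oddD => /negPf-> /negPf->.
  by rewrite addnn odd_double.
have := congr1 odd (sum_equated D eqs).
by rewrite oddD oddw (negPf even_degree) oddM => /esym/andP[].
Qed.

Lemma equatable_card_lt_neighborhood I U w : neighborhood I \subset U ->
    equatable w -> \sum_(x in I) w x < \sum_(x in U) w x ->
  #|I| < #|U|.
Proof.
move=> /subsetP sNIU /equatableP[s [c [/allP ads eqs]]] ltw.
have le_degree : \sum_(x in I) degree s x <= \sum_(x in U) degree s x.
  have adj_le x y : adj x y -> (x \in I) <= (y \in U).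
    case: (boolP (x \in I)) => // xI xy.
    by rewrite sNIU //; apply/neighborhoodP; exists x.
  rewrite !sum_degree !big_seq; apply: leq_sum => e /ads ade.
  by rewrite addnC leq_add ?adj_le // adj_sym.
have : #|I| * c < #|U| * c.
  by rewrite -!(sum_equated _ eqs) -addSn leq_add.
by rewrite ltn_mul2r => /andP[].
Qed.

Lemma equatable_pair (v u : G) :
    (forall S : {set G}, S != set0 -> S != setT -> #|S| < #|neighborhood S|) ->
  equatable [ffun x => (x == v) + (x == u)].
Proof.
case/(near_perfect_matching v u) => f [f_adj f_inj] f_im.
apply/equatableP; exists [seq (x, f x) | x in [set~ v]], 2; split.
  by apply/allP => _ /imageP[x /f_adj fx ->]; rewrite inE in fx.
by move=> x; rewrite ffunE degree_graph // f_im !inE; do 2!case: eqP.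
Qed.

End Equatable.

Section EvenSum.
Variable G : sgraph.
Hypothesis equatable_pairs :
  forall v u : G, equatable [ffun x => (x == v) + (x == u)].
Implicit Types w : {ffun G -> nat}.

Lemma equatable_even_sum w : ~~ odd (\sum_x w x) -> equatable w.
Proof.
move=> /even_halfK; move: (_./2) => n.
elim: n w => [|n IHn] w /esym sumw.
  move/eqP: sumw; rewrite sum_nat_eq0 => /forallP w0.
  suff -> : w = [ffun=> 0] by apply: equatable_const.
  by apply/ffunP => x; rewrite ffunE; apply/eqP/w0.
rewrite doubleS in sumw; have [v [w1 [-> sumw1]]] := sum_natS_split sumw.
have [u [w2 [-> sumw2]]] := sum_natS_split sumw1.
have := equatable_add (equatable_pairs v u) (IHn w2 (esym sumw2)).
by congr equatable; apply/ffunP => x; rewrite !ffunE addnA.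
Qed.

Lemma equatable_odd_card w : odd #|G| -> equatable w.
Proof.
move=> oddG; have [odd_sum|] := boolP (odd (\sum_x w x)); last first.
  exact: equatable_even_sum.
apply: (@equatable_addn_cancel _ _ 1); apply: equatable_even_sum.
under eq_bigr do rewrite ffunE.
by rewrite big_split sum1_card oddD odd_sum oddG.
Qed.

End EvenSum.

Theorem theorem1 (G : sgraph) (G_nonempty : 0 < #|G|) :
  (forall w : {ffun G -> nat}, equatable w) <->
  [/\ connected G, odd #|G| &
      forall U : {set G}, U != set0 -> #|isolated (remove_vertices U)| < #|U|].
Proof.
split=> [equatableG|[connG oddG isolation] w]; last first.
  apply: equatable_odd_card oddG => v u; apply: equatable_pair.
  apply: card_lt_neighborhood => // U U0.
  by rewrite -card_isolated_by isolation.
have odd_closed (D : {set G}) : closed adj D -> D != set0 -> odd #|D|.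
  move=> closD /set0Pn[z zD].
  apply: equatable_odd_closed closD (equatableG (indicator [set z])) _.
  by rewrite sum_indicator (setIidPr _) ?sub1set ?cards1.
have oddG : odd #|G|.
  by rewrite -cardsT odd_closed -?card_gt0 ?cardsT // => x y _; rewrite !inE.
split=> // [|U U0]; first exact: odd_closed_connected odd_closed.
rewrite card_isolated_by.
apply: equatable_card_lt_neighborhood (equatableG (indicator U)) _.
  exact: neighborhood_isolated_by.
rewrite !sum_indicator setIid disjoint_setI0 ?disjoint_isolated_by //.
by rewrite cards0 card_gt0.
Qed.
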